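(* Let $\Omega=\Omega_D$ be an open circular domain in $\mathbb{H}$. For every slice function $f:\Omega\to\mathbb{H}$ of class $\mathcal{C}^1(\Omega)$, the following formulas hold on $\Omega\setminus\mathbb{R}$: (a) $\Gamma f=2\operatorname{Im}(x)f'_s$. (b) $\overline\partial_{CRF}f-\overline\vartheta f=-2f'_s$.
   Context: $\mathbb{H}$ is the algebra of quaternions $x=x_0+x_1i+x_2j+x_3k$, with conjugation $\overline x=x_0-x_1i-x_2j-x_3k$, $\operatorname{Im}(x)=x_1i+x_2j+x_3k$, and $\mathbb{S}_{\mathbb{H}}=\{J\in\mathbb{H}:J^2=-1\}$. For $D\subseteq\mathbb{C}$ invariant under complex conjugation, $\Omega_D=\{\alpha+J\beta:\alpha+\sqrt{-1}\,\beta\in D,\ J\in\mathbb{S}_{\mathbb{H}}\}$ (circular set). A stem function on $D$ is a map $F=F_1+\imath F_2:D\to\mathbb{H}\otimes_{\mathbb{R}}\mathbb{C}$ ($F_1,F_2$ being $\mathbb{H}$-valued, $\imath^2=-1$) with $F(\overline z)=\overline{F(z)}$, where $\overline{a+\imath b}=a-\imath b$ for $a,b\in\mathbb{H}$. It induces the (left) slice function $f=\mathcal{I}(F):\Omega_D\to\mathbb{H}$, $f(\alpha+J\beta)=F_1(z)+JF_2(z)$, $z=\alpha+\sqrt{-1}\,\beta$. The spherical derivative of $f$ is $f'_s(x)=\frac12\operatorname{Im}(x)^{-1}(f(x)-f(\overline x))$, $x\notin\mathbb{R}$. Operators (coefficients multiply from the left; $\partial_l=\partial/\partial x_l$): $\overline\partial_{CRF}=\partial_0+i\partial_1+j\partial_2+k\partial_3$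 (Cauchy-Riemann-Fueter operator); $\overline\vartheta=\partial_0+\frac{\operatorname{Im}(x)}{|\operatorname{Im}(x)|^2}\sum_{l=1}^3x_l\partial_l$; $L_{lm}=x_l\partial_m-x_m\partial_l$ and $\Gamma=-iL_{23}+jL_{13}-kL_{12}$ (quaternionic spherical Dirac operator). *)

(* Defs.v *)
From HB Require Import structures.
From mathcomp Require Import all_boot all_order all_algebra.
From mathcomp Require Import all_classical all_reals all_analysis.
From mathcomp Require Import complex.
From mathcomp Require Import ring.
Set Implicit Arguments.
Unset Strict Implicit.
Unset Printing Implicit Defensive.
Import Order.TTheory GRing.Theory Num.Theory.
Import numFieldNormedType.Exports.
Local Open Scope classical_set_scope.
Local Open Scope ring_scope.

(* The quaternion x_0 + x_1 i + x_2 j + x_3 k is the row vector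
   (x_0, x_1, x_2, x_3). The norm `|x| inherited from 'rV[R]_4 is the sup norm;
   it only serves to define the (usual) topology and differentiability. The
   Euclidean modulus is [qabs] below. *)
Definition quat (R : Type) : Type := 'rV[R]_4.

HB.instance Definition _ (R : realType) :=
  NormedModule.copy (quat R) ('rV[R]_4).

Section QuatAlgebra.
Variable R : realType.
Implicit Types (x y z : quat R) (a b c d : R).

Definition qcoord (l : 'I_4) x : R := x 0 l.

Definition Quat a b c d : quat R := \row_(l < 4) [:: a; b; c; d]`_l.

Lemma quatP x y :
  qcoord 0 x = qcoord 0 y -> qcoord 1 x = qcoord 1 y ->
  qcoord 2 x = qcoord 2 y -> qcoord 3 x = qcoord 3 y -> x = y.
Proof.
move=> e0 e1 e2 e3; apply/rowP => -[[|[|[|[|//]]]] lt].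
- by move: e0; rewrite /qcoord; congr (x 0 _ = y 0 _); apply: val_inj.
- by move: e1; rewrite /qcoord; congr (x 0 _ = y 0 _); apply: val_inj.
- by move: e2; rewrite /qcoord; congr (x 0 _ = y 0 _); apply: val_inj.
- by move: e3; rewrite /qcoord; congr (x 0 _ = y 0 _); apply: val_inj.
Qed.

Lemma qcoord_Quat a b c d :
  (qcoord 0 (Quat a b c d) = a) * (qcoord 1 (Quat a b c d) = b) *
  (qcoord 2 (Quat a b c d) = c) * (qcoord 3 (Quat a b c d) = d).
Proof. by rewrite /qcoord /Quat !mxE. Qed.

Lemma qcoordD l x y : qcoord l (x + y) = qcoord l x + qcoord l y.
Proof. by rewrite /qcoord mxE. Qed.

Lemma qcoordN l x : qcoord l (- x) = - qcoord l x.
Proof. by rewrite /qcoord mxE. Qed.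

Lemma qcoordZ l a x : qcoord l (a *: x) = a * qcoord l x.
Proof. by rewrite /qcoord mxE. Qed.

Lemma qcoord0 l : qcoord l 0 = 0.
Proof. by rewrite /qcoord mxE. Qed.

Definition qone : quat R := Quat 1 0 0 0.

Definition qmul x y : quat R :=
  let x0 := qcoord 0 x in let x1 := qcoord 1 x in
  let x2 := qcoord 2 x in let x3 := qcoord 3 x in
  let y0 := qcoord 0 y in let y1 := qcoord 1 y in
  let y2 := qcoord 2 y in let y3 := qcoord 3 y in
  Quat (x0 * y0 - x1 * y1 - x2 * y2 - x3 * y3)
       (x0 * y1 + x1 * y0 + x2 * y3 - x3 * y2)
       (x0 * y2 - x1 * y3 + x2 * y0 + x3 * y1)
       (x0 * y3 + x1 * y2 - x2 * y1 + x3 * y0).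

Definition qE :=
  (qcoord_Quat, qcoordD, qcoordN, qcoordZ, qcoord0).

Lemma qmulA : associative qmul.
Proof. by move=> x y z; apply: quatP; rewrite /qmul !qE; ring. Qed.

Lemma qmul1 : left_id qone qmul.
Proof. by move=> x; apply: quatP; rewrite /qmul /qone !qE; ring. Qed.

Lemma qmulr1 : right_id qone qmul.
Proof. by move=> x; apply: quatP; rewrite /qmul /qone !qE; ring. Qed.

Lemma qmulDl : left_distributive qmul +%R.
Proof. by move=> x y z; apply: quatP; rewrite /qmul !qE; ring. Qed.

Lemma qmulDr : right_distributive qmul +%R.
Proof. by move=> x y z; apply: quatP; rewrite /qmul !qE; ring. Qed.

Lemma qone_neq0 : qone != 0.
Proof.
apply/eqP => /(congr1 (qcoord 0)).
by rewrite /qone !qE => /eqP; rewrite oner_eq0.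
Qed.

HB.instance Definition _ := GRing.Zmodule_isNzRing.Build (quat R)
  qmulA qmul1 qmulr1 qmulDl qmulDr qone_neq0.

Lemma qscalerAl a x y : a *: (x * y) = (a *: x) * y.
Proof. by apply: quatP; rewrite /GRing.mul /= /qmul !qE; ring. Qed.

HB.instance Definition _ :=
  GRing.Lmodule_isLalgebra.Build R (quat R) qscalerAl.

Lemma qscalerAr a x y : a *: (x * y) = x * (a *: y).
Proof. by apply: quatP; rewrite /GRing.mul /= /qmul !qE; ring. Qed.

HB.instance Definition _ :=
  GRing.Lalgebra_isAlgebra.Build R (quat R) qscalerAr.

Definition qi : quat R := Quat 0 1 0 0.
Definition qj : quat R := Quat 0 0 1 0.
Definition qk : quat R := Quat 0 0 0 1.

Definition qconj x : quat R :=
  Quat (qcoord 0 x) (- qcoord 1 x) (- qcoord 2 x) (- qcoord 3 x).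

Definition qIm x : quat R := Quat 0 (qcoord 1 x) (qcoord 2 x) (qcoord 3 x).

Definition qabs x : R := Num.sqrt (\sum_(l < 4) qcoord l x ^+ 2).

Lemma qabs_sqr x : qabs x ^+ 2 = \sum_(l < 4) qcoord l x ^+ 2.
Proof. by rewrite sqr_sqrtr// sumr_ge0// => l _; rewrite sqr_ge0. Qed.

Lemma qabs_sqrE x : qabs x ^+ 2 =
  qcoord 0 x ^+ 2 + qcoord 1 x ^+ 2 + qcoord 2 x ^+ 2 + qcoord 3 x ^+ 2.
Proof.
rewrite qabs_sqr !big_ord_recr big_ord0 /= add0r.
by congr (qcoord _ _ ^+ 2 + qcoord _ _ ^+ 2 + qcoord _ _ ^+ 2 + qcoord _ _ ^+ 2);
  apply: val_inj.
Qed.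

Lemma qabs_sqr_eq0 x : (qabs x ^+ 2 == 0) = (x == 0).
Proof.
apply/eqP/eqP => [|->]; last first.
  by rewrite qabs_sqr big1// => l _; rewrite qcoord0 expr0n.
rewrite qabs_sqr => /psumr_eq0P h; apply/rowP => l.
have /eqP := h (fun l _ => sqr_ge0 _) l isT.
by rewrite sqrf_eq0 => /eqP xl; apply: etrans xl (esym (qcoord0 l)).
Qed.

Definition qinv x : quat R := (qabs x ^- 2) *: qconj x.

Lemma qmulVx : {in [pred x | x != 0], left_inverse 1 qinv *%R}.
Proof.
move=> x; rewrite inE -qabs_sqr_eq0 /qinv => x0.
rewrite -scalerAl; apply: (scalerI x0); rewrite scalerA divff// scale1r.
rewrite qabs_sqrE.
by apply: quatP; rewrite /GRing.mul/= /qmul /GRing.one /= /qone /qconj !qE; ring.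
Qed.

Lemma qmulxV : {in [pred x | x != 0], right_inverse 1 qinv *%R}.
Proof.
move=> x; rewrite inE -qabs_sqr_eq0 /qinv => x0.
rewrite -scalerAr; apply: (scalerI x0); rewrite scalerA divff// scale1r.
rewrite qabs_sqrE.
by apply: quatP; rewrite /GRing.mul/= /qmul /GRing.one /= /qone /qconj !qE; ring.
Qed.

Lemma qunitP x y : y * x = 1 /\ x * y = 1 -> x != 0.
Proof.
by case=> yx _; apply/eqP => x0; move: yx; rewrite x0 mulr0 => /eqP;
  rewrite eq_sym oner_eq0.
Qed.

Lemma qinv_out : {in [predC [pred x | x != 0]], qinv =1 id}.
Proof.
move=> x; rewrite !inE negbK => /eqP ->; rewrite /qinv.
by apply: quatP; rewrite /qconj !qE ?oppr0 mulr0.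
Qed.

HB.instance Definition _ := GRing.NzRing_hasMulInverse.Build (quat R)
  qmulVx qmulxV qunitP qinv_out.

End QuatAlgebra.

Arguments qi {R}.
Arguments qj {R}.
Arguments qk {R}.

Section SliceFunctions.
Variable R : realType.
Implicit Types (D : set R[i]) (Omega : set (quat R)) (f : quat R -> quat R).

Definition qsphere : set (quat R) := [set J | J ^+ 2 = -1].

Definition qreals : set (quat R) := range (fun a : R => a%:A : quat R).

Definition conj_invariant D := forall z, D z -> D (conjc z).

Definition circularization D : set (quat R) :=
  [set x | exists a b J,
     [/\ D (Complex a b), qsphere J & x = a%:A + J * b%:A]].

(* An element a + iota b of the complexified algebra H (x)_R C is the pair
   [Complex a b : (quat R)[i]], whose conjugate [conjc] is a - iota b.
   Functions on D (and on Omega) are total functions of which only the values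
   on D (resp. Omega) matter. *)
Definition stem_function D (F : R[i] -> (quat R)[i]) :=
  forall z, D z -> F (conjc z) = conjc (F z).

Definition induced_by D (F : R[i] -> (quat R)[i]) f :=
  forall a b J, D (Complex a b) -> qsphere J ->
    f (a%:A + J * b%:A) =
      complex.Re (F (Complex a b)) + J * complex.Im (F (Complex a b)).

Definition slice_function D f :=
  exists F, stem_function D F /\ induced_by D F f.

(* f is Frechet differentiable at every point of the open set Omega, with a
   continuous differential. *)
Definition class_C1 Omega f :=
  forall x, Omega x ->
    differentiable f x /\ {for x, continuous (@jacobian 4 4 R f)}.

Definition spherical_derivative f (x : quat R) : quat R :=
  2^-1 *: ((qIm x)^-1 * (f x - f (qconj x))).

Definition partial (l : 'I_4) f (x : quat R) : quat R :=
  'D_(delta_mx 0 l : quat R) f x.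

Definition CRF f (x : quat R) : quat R :=
  partial 0 f x + qi * partial 1 f x + qj * partial 2 f x + qk * partial 3 f x.

Definition theta_bar f (x : quat R) : quat R :=
  partial 0 f x +
  (qabs (qIm x) ^- 2 *: qIm x) *
    (qcoord 1 x *: partial 1 f x + qcoord 2 x *: partial 2 f x
     + qcoord 3 x *: partial 3 f x).

Definition Lop (l m : 'I_4) f (x : quat R) : quat R :=
  qcoord l x *: partial m f x - qcoord m x *: partial l f x.

Definition Gamma f (x : quat R) : quat R :=
  - qi * Lop 2 3 f x + qj * Lop 1 3 f x - qk * Lop 1 2 f x.

End SliceFunctions.

(* Main.v *)
Require Import Defs.
From mathcomp Require Import all_boot all_order all_algebra.
From mathcomp Require Import all_classical all_reals all_analysis.
From mathcomp Require Import complex.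
From mathcomp Require Import ring.
Import Order.TTheory GRing.Theory Num.Theory.
Import numFieldNormedType.Exports.
Local Open Scope classical_set_scope.
Local Open Scope ring_scope.

(** Let x = a + J b be a non-real point and S its sphere
    { a + I b : I ^+ 2 = -1 }. The stem function takes one value F1 + iota F2
    for all of S, so f (a + I b) = F1 + I F2 there: on S, f is affine in the
    point, with right slope F2 / b. This slope is the spherical derivative,
    and f y = f x + (y - x) * f'_s(x) on S ([slice_affine_on_sphere]).

    Hence the derivative of f along a vector w tangent to S at x is w * f'_s(x)
    ([slice_derive_tangent]). The operators L_lm differentiate along
    x_l e_m - x_m e_l, the velocity of the rotation in the (l, m) plane, which
    is tangent to S; so they multiply f'_s(x) on the left by this quaternion
    ([Lop_slice]). Summing the three of them with the coefficients of Gamma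
    gives 2 Im(x) ([Gamma_slice]), which is (a).

    Formula (b) follows from (a), because multiplying Gamma by
    Im(x) / |Im(x)|^2 isolates the part of the Cauchy-Riemann-Fueter operator
    tangent to the spheres, and this part is CRF - theta_bar
    ([CRF_theta_bar_Gamma]). Since Im(x)^2 = - |Im(x)|^2, the factor
    2 Im(x) becomes -2. *)

(** The point runs through an ellipse with center p - u and conjugate radii u
    and w, starting at p with velocity w. The image of such a curve under an
    affine map has the same form, so the statement serves both for a curve in
    the sphere of x and for its image under a slice function. *)
Lemma is_derive_ellipse (R : realType) (V : normedModType R) (p w u : V) :
  is_derive (0 : R) (1 : R) (fun t : R => p + (sin t *: w + (cos t - 1) *: u)) w.
Proof.
have dsin : is_derive (0 : R) (1 : R) (@sin R) 1.
  by apply: is_derive_eq; exact: cos0.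
have dcos : is_derive (0 : R) (1 : R) (fun t : R => cos t - 1) 0.
  by apply: is_derive_eq; rewrite sin0 oppr0 addr0.
have dscale (k : R -> R) (c : R) (v : V) : is_derive (0 : R) (1 : R) k c ->
    is_derive (0 : R) (1 : R) (fun t => k t *: v) (c *: v).
  move=> [dk kc].
  have dk' : differentiable k 0 by apply/derivable1_diffP.
  split; first by apply/derivable1_diffP; exact: differentiableZl.
  rewrite deriveE; last exact: differentiableZl.
  by rewrite diffZl// -deriveE// kc.
have := dscale _ _ w dsin; have := dscale _ _ u dcos => du dw.
apply: is_derive_eq.
by rewrite scale1r scale0r add0r addr0.
Qed.

Section QuaternionAlgebra.
Context {R : realType}.
Implicit Types (x y : quat R).

Lemma qoneE : (1 : quat R) = Quat 1 0 0 0. Proof. by []. Qed.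

Lemma qcoordM x y :
  (qcoord 0 (x * y) = qcoord 0 x * qcoord 0 y - qcoord 1 x * qcoord 1 y
                      - qcoord 2 x * qcoord 2 y - qcoord 3 x * qcoord 3 y) *
  (qcoord 1 (x * y) = qcoord 0 x * qcoord 1 y + qcoord 1 x * qcoord 0 y
                      + qcoord 2 x * qcoord 3 y - qcoord 3 x * qcoord 2 y) *
  (qcoord 2 (x * y) = qcoord 0 x * qcoord 2 y - qcoord 1 x * qcoord 3 y
                      + qcoord 2 x * qcoord 0 y + qcoord 3 x * qcoord 1 y) *
  (qcoord 3 (x * y) = qcoord 0 x * qcoord 3 y + qcoord 1 x * qcoord 2 y
                      - qcoord 2 x * qcoord 1 y + qcoord 3 x * qcoord 0 y).
Proof. by rewrite !qcoord_Quat. Qed.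

Lemma qcoord0_add_qIm x : x = (qcoord 0 x)%:A + qIm x.
Proof. by apply: quatP; rewrite /qIm qoneE !qE; ring. Qed.

Lemma sqr_qIm x : qIm x ^+ 2 = (- qabs (qIm x) ^+ 2)%:A.
Proof.
rewrite qabs_sqrE expr2 qoneE.
by apply: quatP; rewrite !(qcoordM, qE); ring.
Qed.

Lemma delta_quat :
  [/\ delta_mx 0 0 = 1 :> quat R, delta_mx 0 1 = qi :> quat R,
      delta_mx 0 2 = qj :> quat R & delta_mx 0 3 = qk :> quat R].
Proof.
by split; apply: quatP; rewrite ?qoneE /qi /qj /qk !qE /qcoord mxE.
Qed.

(** A square root J of -1 has no real part: the imaginary coordinates of J ^+ 2
    are 2 J_0 J_l, so J_0 != 0 would make J real, with a negative square. *)
Lemma qsphere_qIm (J : quat R) : qsphere J -> qIm J = J.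
Proof.
move=> J2; suff J0 : qcoord 0 J = 0 by apply: quatP; rewrite /qIm !qE.
move: J2; rewrite /qsphere /= expr2 qoneE => J2.
have cJ l := congr1 (qcoord l) J2.
move: (cJ 0) (cJ 1) (cJ 2) (cJ 3); rewrite !(qcoordM, qE).
set a := qcoord 0 J; set b := qcoord 1 J; set c := qcoord 2 J.
set d := qcoord 3 J => e0 e1 e2 e3.
apply/eqP; apply: contraT => a0.
have z (s : R) : a * s + s * a = 0 -> s = 0.
  rewrite mulrC -mulrDr => /eqP; rewrite mulf_eq0 => /orP[/eqP//|].
  by rewrite -mulr2n mulrn_eq0 (negbTE a0).
have b0 : b = 0 by apply: z; rewrite -[RHS]oppr0 -e1; ring.
have c0 : c = 0 by apply: z; rewrite -[RHS]oppr0 -e2; ring.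
have d0 : d = 0 by apply: z; rewrite -[RHS]oppr0 -e3; ring.
have := sqr_ge0 a; rewrite expr2.
move: e0; rewrite b0 c0 d0 !mulr0 !subr0 => ->.
by rewrite oppr_ge0 ler10.
Qed.

End QuaternionAlgebra.

Section SliceFunctions.
Context {R : realType}.
Implicit Types (D : set R[i]) (f : quat R -> quat R) (x y w u : quat R).

(** The conditions on y say that it lies on the sphere of x. With
    x = a + J b, b != 0 but of any sign, y = a + K b for K = b^-1 Im(y), and
    conj x = a + (- J) b: the three values of f that matter are F1 + J F2,
    F1 + K F2 and F1 - J F2, all for the same point a + i b of D. *)
Lemma slice_affine_on_sphere D f x y :
  slice_function D f -> (circularization D `\` @qreals R) x ->
  qcoord 0 y = qcoord 0 x -> qIm y ^+ 2 = qIm x ^+ 2 ->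
  f y = f x + (y - x) * spherical_derivative f x.
Proof.
move=> [F [_ fF]] [[a [b [J [Dab J2 xE]]]] xR] y0 yI.
have JI := qsphere_qIm _ J2.
have b0 : b != 0.
  apply: contra_notN xR => /eqP b0; exists a => //.
  by rewrite xE b0 scale0r mulr0 addr0.
have xI : qIm x = b *: J.
  by rewrite xE -JI -scalerAr mulr1; apply: quatP; rewrite /qIm qoneE !qE; ring.
have x0 : qcoord 0 x = a.
  rewrite xE -JI -scalerAr mulr1 /qIm qoneE !qE; ring.
have [K bK K2] : exists2 K : quat R, qIm y = b *: K & qsphere K.
  exists (b^-1 *: qIm y); first by rewrite scalerA divff// scale1r.
  rewrite /qsphere /= exprZn yI xI exprZn scalerA -exprMn mulVf//.
  by rewrite expr1n scale1r.
have xE' : qconj x = a%:A + (- J) * b%:A.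
  rewrite mulNr -scalerAr mulr1 -xI -x0.
  by apply: quatP; rewrite /qconj /qIm qoneE !qE; ring.
have yE : y = a%:A + K * b%:A.
  by rewrite -scalerAr mulr1 -bK -x0 -y0; exact: qcoord0_add_qIm.
set P := complex.Re (F (Complex a b)); set Q := complex.Im (F (Complex a b)).
have fx : f x = P + J * Q by rewrite xE fF.
have fy : f y = P + K * Q by rewrite yE fF.
have fx' : f (qconj x) = P - J * Q.
  by rewrite xE' fF ?mulNr// /qsphere /= sqrrN.
have Ju : J \is a GRing.unit.
  apply/unitrP; exists (- J).
  by move: J2; rewrite /qsphere /= expr2 mulrN mulNr => ->; rewrite opprK.
have -> : spherical_derivative f x = b^-1 *: Q.
  rewrite /spherical_derivative fx fx' xI.
  have -> : (b *: J)^-1 = b^-1 *: J^-1 by rewrite invrZ// unitfE.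
  rewrite opprD opprK addrACA subrr add0r -mulr2n.
  rewrite -scalerAl mulrnAr mulrA mulVr// mul1r -[Q *+ 2]scaler_nat !scalerA.
  by congr (_ *: _); field.
rewrite fy fx.
have -> : y - x = b *: (K - J).
  by rewrite yE xE -!scalerAr !mulr1 scalerBr opprD addrACA subrr add0r.
rewrite -scalerAl -scalerAr scalerA divff// scale1r mulrBl.
by rewrite -addrA [J * Q + _]addrC subrK.
Qed.

(** The vector w is tangent to the sphere of x because an ellipse with velocity w
    at x stays in the sphere. The image of this ellipse under f is known from
    the affine formula, and the chain rule identifies its velocity. *)
Lemma slice_derive_tangent D f x w u :
  slice_function D f -> (circularization D `\` @qreals R) x ->
  differentiable f x ->
  (forall t : R, let y := x + (sin t *: w + (cos t - 1) *: u) in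
     qcoord 0 y = qcoord 0 x /\ qIm y ^+ 2 = qIm x ^+ 2) ->
  'D_w f x = w * spherical_derivative f x.
Proof.
move=> slf Dx df onS.
pose g := fun t : R => x + (sin t *: w + (cos t - 1) *: u).
set v := spherical_derivative f x.
have g0 : g 0 = x by rewrite /g sin0 cos0 scale0r subrr scale0r !addr0.
have [dg g'] := is_derive_ellipse R _ x w u.
have {}dg : differentiable g 0 by apply/derivable1_diffP.
have fg : f \o g = fun t => f x + (sin t *: (w * v) + (cos t - 1) *: (u * v)).
  apply/funext => t /=; have [y0 yI] := onS t.
  rewrite (slice_affine_on_sphere _ _ _ _ slf Dx y0 yI) addrAC subrr add0r.
  by rewrite mulrDl !scalerAl.
have [_ fg'] := is_derive_ellipse R _ (f x) (w * v) (u * v).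
move: fg'; rewrite -fg deriveE; last by apply: differentiable_comp; rewrite ?g0.
rewrite diff_comp ?g0//= -[X in 'd f x X]deriveE// g' => <-.
by rewrite deriveE.
Qed.

(** The ellipse is here the orbit of x under the rotations of the (l, m) plane:
    u is the projection of x to this plane and w is u turned by a right
    angle. *)
Lemma Lop_slice D f x (l m : 'I_4) :
  slice_function D f -> (circularization D `\` @qreals R) x ->
  differentiable f x -> (l, m) \in [:: (2, 3); (1, 3); (1, 2)] ->
  Lop l m f x =
    (qcoord l x *: delta_mx 0 m - qcoord m x *: delta_mx 0 l : quat R)
    * spherical_derivative f x.
Proof.
move=> slf Dx df lm.
have -> : Lop l m f x =
    'D_(qcoord l x *: delta_mx 0 m - qcoord m x *: delta_mx 0 l : quat R) f x.
  by rewrite /Lop /partial !deriveE// linearB !linearZ.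
apply: (slice_derive_tangent D f x _
  (qcoord l x *: delta_mx 0 l + qcoord m x *: delta_mx 0 m : quat R)) => // t.
have cs : (cos t) ^+ 2 = 1 - (sin t) ^+ 2 := cos2sin2 t.
have [_ e1 e2 e3] := delta_quat (R := R).
rewrite /= !sqr_qIm !qabs_sqrE.
move: lm; rewrite !inE => /or3P[] /eqP[-> ->]; rewrite ?e1 ?e2 ?e3 /=;
  rewrite /qIm /qi /qj /qk !qE; (split; first by ring); congr (_ *: _); ring: cs.
Qed.

(** Purely algebraic in the partial derivatives: the coefficient of the partial
    derivative along e_1 in Im(x) Gamma is
    Im(x) (x_2 k - x_3 j) = |Im(x)|^2 i - x_1 Im(x), and cyclically. *)
Lemma CRF_theta_bar_Gamma f x : qIm x != 0 ->
  CRF f x - theta_bar f x = (qabs (qIm x) ^- 2 *: qIm x) * Gamma f x.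
Proof.
rewrite -qabs_sqr_eq0 => x0.
apply: (scalerI x0 (V := quat R)).
rewrite -scalerAl [RHS]scalerA divff// scale1r.
have cancel (p a b c t : quat R) : p + a + b + c - (p + t) = a + b + c - t.
  by rewrite -(addrA _ b c) -(addrA p a) opprD addrACA subrr add0r !addrA.
rewrite /theta_bar /CRF -scalerAl cancel.
rewrite scalerDr scalerN scalerA divff// scale1r qabs_sqrE.
rewrite /Gamma /Lop.
(* as variables, the partial derivatives are atoms that [ring] compares fast *)
move: (partial 1 f x) (partial 2 f x) (partial 3 f x) => p1 p2 p3.
by apply: quatP; do 3! rewrite ?qcoordD ?qcoordN ?qcoordZ ?qcoordM;
  rewrite !qcoord_Quat; ring.
Qed.

Lemma Gamma_slice D f x :
  slice_function D f -> (circularization D `\` @qreals R) x ->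
  differentiable f x ->
  Gamma f x = 2 * qIm x * spherical_derivative f x.
Proof.
move=> slf Dx df; have [_ e1 e2 e3] := delta_quat (R := R).
rewrite /Gamma !(Lop_slice D)// e1 e2 e3 !mulrA -mulrDl -mulrBl mulr_natl.
congr (_ * _); rewrite mulr2n.
by apply: quatP; rewrite !(qcoordM, qE); ring.
Qed.

End SliceFunctions.

Theorem proposition6p1 (R : realType) (D : set R[i]) (f : quat R -> quat R) :
  conj_invariant D ->
  open (circularization D) ->
  slice_function D f ->
  class_C1 (circularization D) f ->
  (forall x : quat R, (circularization D `\` @qreals R) x ->
     Gamma f x = 2 * qIm x * spherical_derivative f x) /\
  (forall x : quat R, (circularization D `\` @qreals R) x ->
     CRF f x - theta_bar f x = - 2 * spherical_derivative f x).
Proof.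
move=> _ _ slf C1.
have part_a x (Dx : (circularization D `\` @qreals R) x) :
    Gamma f x = 2 * qIm x * spherical_derivative f x.
  by apply: (Gamma_slice D) => //; have [] := C1 x Dx.1.
split=> // x Dx.
have Ix : qIm x != 0.
  apply: contra_notN Dx.2 => /eqP Ix0; exists (qcoord 0 x) => //.
  by rewrite [RHS](qcoord0_add_qIm x) Ix0 addr0.
rewrite CRF_theta_bar_Gamma// part_a// mulrA; congr (_ * _).
rewrite mulr_natl -scalerAl mulrnAr -expr2 sqr_qIm -scalerMnr scalerA mulrN.
by rewrite mulVf ?qabs_sqr_eq0// scaleN1r mulNrn.
Qed.
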